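(* For any collection $\mathcal{E}$ of spaces and any map $f:X\to Y$, $$\mathcal{E}\text{-}\mathrm{cat}_{\mathrm{CP}}(f)\le\mathcal{E}\text{-}\mathrm{secat}(f).$$
   Context: All spaces are assumed to have the homotopy type of connected CW-complexes; spaces have no base points and maps are not required to preserve base points. A collection $\mathcal{E}$ of spaces means any collection of spaces containing the one-point space $*$. Given $f:X\to Y$, a subset $U\subseteq Y$ with inclusion $i:U\hookrightarrow Y$ is $\mathcal{E}$-section-categorical (with respect to $f$) if there are a space $E\in\mathcal{E}$ and maps $u:U\to E$, $v:E\to X$ with $fvu\simeq i$. The (reduced) $\mathcal{E}$-sectional category $\mathcal{E}\text{-}\mathrm{secat}(f)$ is the smallest integer $n\ge 0$ such that $Y$ has an open cover by $n+1$ subsets each of which is $\mathcal{E}$-section-categorical with respect to $f$ (and $\infty$ if no such $n$ exists). The (reduced) $\mathcal{E}$-Clapp-Puppe category $\mathcal{E}\text{-}\mathrm{cat}_{\mathrm{CP}}(f)$ of a map $f:X\to Y$ is the smallest integer $n\ge0$ such that there are an open cover $\{U_0,\dots,U_n\}$ of $X$, spaces $E_i\in\mathcal{E}$ and maps $u_i:U_i\to E_i$, $v_i:E_i\to Y$ with $f|_{U_i}\simeq v_iu_i$ for each $i$ ($\infty$ if no such $n$ exists). *)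

(* Defs.v *)
From HB Require Import structures.
From mathcomp Require Import all_boot all_order all_algebra.
From mathcomp Require Import all_classical all_reals all_analysis.

Set Implicit Arguments.
Unset Strict Implicit.
Unset Printing Implicit Defensive.

Import Order.TTheory GRing.Theory Num.Theory.
Import numFieldNormedType.Exports.

Local Open Scope classical_set_scope.
Local Open Scope ring_scope.

Definition homotopic (R : realType) (A B : topologicalType) (f g : A -> B) :
    Prop :=
  exists H : A * R -> B,
    [/\ {within [set: A] `*` `[0, 1], continuous H},
        (forall a, H (a, 0) = f a)
      & (forall a, H (a, 1) = g a)].

Definition homotopy_equivalent (R : realType) (A B : topologicalType) : Prop :=
  exists (f : A -> B) (g : B -> A),
    [/\ continuous f, continuous g,
        homotopic R (g \o f) id & homotopic R (f \o g) id].

(* The norm the library puts on 'rV[R]_n is the sup norm, so the Euclidean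
   discs and spheres are written out. *)
Definition disc (R : realType) (n : nat) : set 'rV[R]_n :=
  [set x | \sum_(k < n) x 0 k ^+ 2 <= 1].

Definition open_disc (R : realType) (n : nat) : set 'rV[R]_n :=
  [set x | \sum_(k < n) x 0 k ^+ 2 < 1].

Definition sphere (R : realType) (n : nat) : set 'rV[R]_n :=
  [set x | \sum_(k < n) x 0 k ^+ 2 = 1].

Arguments disc R n : clear implicits.
Arguments open_disc R n : clear implicits.
Arguments sphere R n : clear implicits.

(* Whitehead's definition, in terms of characteristic maps.  The third and
   fourth clauses of [CW_structure] say that each characteristic map restricts
   to a homeomorphism from the open disc onto its image; the last two are
   closure-finiteness and the weak topology. *)
Record CW_structure (R : realType) (K : topologicalType) (I : Type)
    (dim : I -> nat) (phi : forall i, 'rV[R]_(dim i) -> K) : Prop := {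
  CW_hausdorff : hausdorff_space K;
  CW_continuous : forall i, {within disc R (dim i), continuous (phi i)};
  CW_injective : forall i, {in open_disc R (dim i) &, injective (phi i)};
  CW_embedding : forall i (V : set 'rV[R]_(dim i)), open V ->
    exists2 W : set K, open W &
      phi i @` (open_disc R (dim i) `&` V)
        = W `&` (phi i @` open_disc R (dim i));
  CW_disjoint : trivIset setT (fun i => phi i @` open_disc R (dim i));
  CW_cover : \bigcup_i (phi i @` open_disc R (dim i)) = [set: K];
  CW_closure_finite : forall i, exists J : set I,
    [/\ finite_set J, (forall j, J j -> (dim j < dim i)%N) &
        phi i @` sphere R (dim i)
          `<=` \bigcup_(j in J) (phi j @` open_disc R (dim j))];
  CW_weak : forall A : set K,
    (forall i, closed (A `&` closure (phi i @` open_disc R (dim i)))) ->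
    closed A }.

Definition CW_complex (R : realType) (K : topologicalType) : Prop :=
  exists (I : Type) (dim : I -> nat) (phi : forall i, 'rV[R]_(dim i) -> K),
    CW_structure phi.

Definition is_space (R : realType) (X : topologicalType) : Prop :=
  exists K : topologicalType,
    [/\ CW_complex R K, connected [set: K] & homotopy_equivalent R X K].

(* Spaces are not identified up to homeomorphism, hence "some one-point space"
   instead of a fixed one. *)
Definition is_collection (R : realType) (E : topologicalType -> Prop) : Prop :=
  (forall Z, E Z -> is_space R Z) /\
  (exists2 P : topologicalType, E P & exists p : P, forall q : P, q = p).

(* Below, [U : set X] used as a type is [set_type U] with its subspace topology
   and [set_val] is the inclusion. *)
Definition section_categorical (R : realType) (E : topologicalType -> Prop)
    (X Y : topologicalType) (f : X -> Y) (U : set Y) : Prop :=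
  exists (Z : topologicalType) (u : U -> Z) (v : Z -> X),
    [/\ E Z, continuous u, continuous v
      & homotopic R (f \o v \o u) (set_val : U -> Y)].

Definition factor_categorical (R : realType) (E : topologicalType -> Prop)
    (X Y : topologicalType) (f : X -> Y) (U : set X) : Prop :=
  exists (Z : topologicalType) (u : U -> Z) (v : Z -> Y),
    [/\ E Z, continuous u, continuous v
      & homotopic R (f \o (set_val : U -> X)) (v \o u)].

Definition covered_by (X : topologicalType) (P : set X -> Prop) (n : nat) :
    Prop :=
  exists U : 'I_n.+1 -> set X,
    [/\ (forall i, open (U i)), \bigcup_i U i = [set: X]
      & forall i, P (U i)].

(* The least natural number satisfying [P], and +oo if there is none. *)
Definition least (R : realType) (P : nat -> Prop) : \bar R :=
  match pselect (exists n, `[< P n >]) with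
  | left exP => (ex_minn exP)%:R%:E
  | right _ => +oo%E
  end.

Definition secat (R : realType) (E : topologicalType -> Prop)
    (X Y : topologicalType) (f : X -> Y) : \bar R :=
  least R (covered_by (section_categorical R E f)).

Definition cat_CP (R : realType) (E : topologicalType -> Prop)
    (X Y : topologicalType) (f : X -> Y) : \bar R :=
  least R (covered_by (factor_categorical R E f)).

(* Main.v *)
Require Import Defs.
From mathcomp Require Import all_boot all_order all_algebra.
From mathcomp Require Import all_classical all_reals all_analysis.

(** Pulling an open cover of [Y] back along [f] turns section-categorical sets
    into factor-categorical ones.  If [U] is open in [Y] and [f \o v \o u] is
    homotopic to the inclusion of [U], with [u : U -> Z] and [v : Z -> X], let
    [f'] be the corestriction [f @^-1` U -> U] of [f].  Composing the homotopy
    with [f'] gives a homotopy from [(f \o v) \o (u \o f')] to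
    [set_val \o f'], and the latter is the restriction of [f] to [f @^-1` U].
    So this restriction factors up to homotopy through the same [Z], and [f]
    has Clapp-Puppe covers of every size for which it has sectional covers
    ([factor_categorical_preimage], [covered_by_preimage]); the inequality
    between the two minima is then [least_anti]. *)

Set Implicit Arguments.
Unset Strict Implicit.
Unset Printing Implicit Defensive.

Import Order.TTheory GRing.Theory Num.Theory.
Import numFieldNormedType.Exports.

Local Open Scope classical_set_scope.
Local Open Scope ring_scope.

(** A homotopy may be discontinuous off the unit interval, so each change of
    variables in it has to map the cylinder into the cylinder. *)
Lemma within_continuous_precomp (S T W : topologicalType) (A : set S)
    (B : set T) (g : S -> T) (h : T -> W) :
  continuous g -> (forall x, A x -> B (g x)) ->
  {within B, continuous h} -> {within A, continuous (h \o g)}.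
Proof.
move=> cg AB /subspace_continuousP ch; apply/subspace_continuousP => x Ax.
move=> V /(ch _ (AB _ Ax)) /(cg x _).
by apply: (@filterS _ (nbhs x)) => y /= gyV Ay; exact/gyV/AB.
Qed.

Lemma continuous_prod_map (S S' T T' : topologicalType) (k : S -> S')
    (l : T -> T') :
  continuous k -> continuous l ->
  continuous (fun z : S * T => (k z.1, l z.2)).
Proof.
move=> ck cl [s t].
apply: (@cvg_pair _ _ _ _ (nbhs (k s)) (nbhs (l t))) => /=.
- exact: (@cvg_comp _ _ _ fst k _ (nbhs s) _ cvg_fst (ck s)).
- exact: (@cvg_comp _ _ _ snd l _ (nbhs t) _ cvg_snd (cl t)).
Qed.

Lemma homotopic_sym (R : realType) (A B : topologicalType) (f g : A -> B) :
  homotopic R f g -> homotopic R g f.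
Proof.
move=> [H [cH H0 H1]]; exists (H \o (fun z => (z.1, 1 - z.2))); split.
- apply: (within_continuous_precomp _ _ cH).
    apply: (@continuous_prod_map _ _ _ _ id (fun t : R => 1 - t)).
      by move=> a; exact: cvg_id.
    by move=> t; apply: cvgB; [exact: cvg_cst | exact: cvg_id].
  move=> [a t] [_ /=]; rewrite !in_itv /= => /andP[t0 t1]; split=> //.
  by rewrite subr_ge0 t1 gerBl t0.
- by move=> a /=; rewrite subr0.
- by move=> a /=; rewrite subrr.
Qed.

Lemma homotopic_precomp (R : realType) (A B C : topologicalType) (k : C -> A)
    (f g : A -> B) :
  continuous k -> homotopic R f g -> homotopic R (f \o k) (g \o k).
Proof.
move=> ck [H [cH H0 H1]]; exists (H \o (fun z => (k z.1, z.2))); split.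
- apply: (within_continuous_precomp _ _ cH) => [|[c t] [_ ?] //].
  apply: (@continuous_prod_map _ _ _ _ k (fun t : R => t)) => // t.
  exact: cvg_id.
- by move=> c /=; exact: H0.
- by move=> c /=; exact: H1.
Qed.

Definition corestr_preimage (X Y : Type) (f : X -> Y) (U : set Y)
    (x : f @^-1` U) : U :=
  SigSub (mem_set (set_valP x : U (f (set_val x)))).

Lemma continuous_corestr_preimage (X Y : topologicalType) (f : X -> Y)
    (U : set Y) :
  continuous f -> continuous (@corestr_preimage X Y f U).
Proof.
move=> cf; apply: continuous_comp_initial => x.
apply: (@continuous_comp _ _ _ (set_val : f @^-1` U -> X) f); last exact: cf.
exact: initial_continuous.
Qed.

Lemma factor_categorical_preimage (R : realType) (E : topologicalType -> Prop)
    (X Y : topologicalType) (f : X -> Y) (U : set Y) :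
  continuous f -> section_categorical R E f U ->
  factor_categorical R E f (f @^-1` U).
Proof.
move=> cf [Z [u [v [EZ cu cv fvu]]]].
have cf' := @continuous_corestr_preimage _ _ f U cf.
exists Z, (u \o @corestr_preimage _ _ f U), (f \o v); split=> //.
- by move=> x; apply: continuous_comp; [exact: cf' | exact: cu].
- by move=> z; apply: continuous_comp; [exact: cv | exact: cf].
(* The end [set_val \o corestr_preimage] of the pulled-back homotopy is
   convertible to the required [f \o set_val]; only its direction is wrong. *)
- exact: homotopic_sym (homotopic_precomp cf' fvu).
Qed.

Lemma covered_by_preimage (X Y : topologicalType) (f : X -> Y)
    (P : set X -> Prop) (Q : set Y -> Prop) (n : nat) :
  continuous f -> (forall U, Q U -> P (f @^-1` U)) ->
  Defs.covered_by Q n -> Defs.covered_by P n.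
Proof.
move=> cf QP [U [oU cU QU]]; exists (fun i => f @^-1` U i); split.
- by move=> i; apply: open_comp => // x _; exact: cf.
- by rewrite -preimage_bigcup cU preimage_setT.
- by move=> i; exact: QP.
Qed.

Lemma least_anti (R : realType) (P Q : nat -> Prop) :
  (forall n, P n -> Q n) -> (least R Q <= least R P)%E.
Proof.
move=> PQ; rewrite /least; case: pselect => [exQ|nQ]; case: pselect => [exP|_].
- case: ex_minnP => n _ Qmin; case: ex_minnP => m /asboolP Pm _.
  by rewrite lee_fin ler_nat Qmin//; apply/asboolP/PQ.
- exact: leey.
- by case: nQ; have [n /asboolP Pn] := exP; exists n; apply/asboolP/PQ.
- by [].
Qed.

Local Open Scope ereal_scope.

Theorem proposition5p10 (R : realType) (E : topologicalType -> Prop)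
    (X Y : topologicalType) (f : X -> Y)
    (hE : is_collection R E) (hX : is_space R X) (hY : is_space R Y)
    (hf : continuous f) :
  cat_CP R E f <= secat R E f.
Proof.
apply: least_anti => n; apply: covered_by_preimage => // U.
exact: factor_categorical_preimage.
Qed.
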